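(* Let $m\ge1$. If $p_m>0$, then for every $\delta>0$ one has $$\liminf_{n\to\infty} n^{-1}\log\mathbb P\bigl(n^{-1}\log N_n\ge\log\rho_m-\delta\bigr)\ge \log p_m.$$ Moreover, there is a constant $c_m>0$ depending only on $m$ such that $\mathbb E[N_n]\ge c_m(p_m\rho_m)^n$ for all $n\ge1$. In particular, if $p_m\rho_m>1$, then $\mathbb E[N_n]$ grows exponentially.
   Context: For an integer $m\ge1$, $A_m$ is the $m\times m$ matrix whose first row consists of ones, whose subdiagonal entries equal one, and all of whose other entries are zero; $\rho_m$ is its Perron root, i.e. its spectral radius. Fix $0<\varepsilon<1$. For $a,b>0$ let $h(a,b):=ab/(a+b)$, and let $U_\varepsilon:=\{(a,b)\in(0,\infty)^2: |a-2|\le\varepsilon,\ |b-2|\le\varepsilon,\ h(a,b)\le1\}$. Let $\mu_\varepsilon$ be a probability measure supported on $U_\varepsilon$ and let the layers $(\omega_n)_{n\ge1}$ be i.i.d. with law $\mu_\varepsilon$. For $\omega=(a,b)\in U_\varepsilon$ put $c(\omega):=b/(a+b)$, $h(\omega):=ab/(a+b)$, $\eta(\omega):=1-h(\omega)$, and $T_\omega(x):=\max\{0,\min(ax,b(1-x))\}$, which maps $[0,1]$ into $[0,1]$. Set $F_n:=T_{\omega_n}\circ\cdots\circ T_{\omega_1}$ and let $N_n$ be the smallest number of subintervals partitioning $[0,1]$ on each of which $F_n$ is affine. Put $\delta_\varepsilon:=\frac12\inf_{\omega\in U_\varepsilon}\min\{c(\omega),1-c(\omega)\}=(2-\varepsilon)/8$,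 $K_\varepsilon:=2+\varepsilon$ and $r_i:=\delta_\varepsilon K_\varepsilon^{-i}$ for $i=0,\dots,m$. Set $p_m:=\mathbb P(\eta(\omega_1)\le r_m)$, the probability that a layer is $m$-favorable. *)

(* Defs.v *)
From HB Require Import structures.
From mathcomp Require Import all_boot all_order all_algebra.
From mathcomp Require Import complex.
From mathcomp Require Import all_classical all_reals all_analysis.
From mathcomp Require Import lra ring.

Set Implicit Arguments.
Unset Strict Implicit.
Unset Printing Implicit Defensive.

Import Order.TTheory GRing.Theory Num.Theory.
Import numFieldNormedType.Exports.

Local Open Scope classical_set_scope.
Local Open Scope ring_scope.

Definition step_mx (R : realType) (m : nat) : 'M[R]_m :=
  \matrix_(i, j) (((i : nat) == 0%N) || ((i : nat) == j.+1))%:R.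

(* The eigenvalues are taken in R[i], so non-real ones are included. *)
Definition spectral_radius (R : realType) (m : nat) (A : 'M[R]_m) : R :=
  sup [set ComplexField.Normc.normc z | z in
        [set z : R[i] | eigenvalue (map_mx (real_complex R) A) z]].

Definition rho (R : realType) (m : nat) : R := spectral_radius (step_mx R m).

Section Layers.
Variable R : realType.
Implicit Types (eps x : R) (w : R * R).

Definition peak_pos w : R := w.2 / (w.1 + w.2).

Definition peak w : R := w.1 * w.2 / (w.1 + w.2).

Definition eta w : R := 1 - peak w.

Definition layer_set eps : set (R * R) :=
  [set w | [/\ 0 < w.1, 0 < w.2,
               `|w.1 - 2| <= eps, `|w.2 - 2| <= eps & peak w <= 1]].

Definition tent w x : R := Num.max 0 (Num.min (w.1 * x) (w.2 * (1 - x))).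

(* Layers are indexed from 0: [om i] is the layer written omega_(i+1) on paper,
   so that [network om n] is the composition of the first n layers. *)
Fixpoint network (om : nat -> R * R) (n : nat) (x : R) : R :=
  if n is k.+1 then tent (om k) (network om k x) else x.

Definition affine_on (D : set R) (f : R -> R) : Prop :=
  exists p q : R, forall x, D x -> f x = p * x + q.

Definition affine_partition (f : R -> R) (k : nat) : Prop :=
  exists t : nat -> R,
    [/\ t 0%N = 0, t k = 1,
        forall i, (i < k)%N -> t i < t i.+1 &
        forall i, (i < k)%N -> affine_on `[t i, t i.+1] f].

(* The default value 0 is only used when no finite partition exists, which
   never happens for a composition of tent maps. *)
Definition num_pieces (f : R -> R) : nat :=
  xget 0%N [set k | affine_partition f k /\
                    forall l, affine_partition f l -> (k <= l)%N].

Definition delta_layer eps : R :=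
  2^-1 * inf [set Num.min (peak_pos w) (1 - peak_pos w) | w in layer_set eps].

Lemma delta_layerE eps : 0 < eps -> eps < 1 ->
  delta_layer eps = (2 - eps) / 8.
Proof.
move=> e0 e1; rewrite /delta_layer.
set S := [set _ | _ in _].
have lbS x : S x -> (2 - eps) / 4 <= x.
  move=> [[a b] /= [/= a0 b0]].
  rewrite !ler_norml => /andP[a1 a2] /andP[b1 b2] _ <-.
  have ab0 : 0 < a + b by rewrite addr_gt0.
  have -> : 1 - peak_pos (a, b) = a / (a + b).
    by rewrite /peak_pos /=; field; rewrite gt_eqF.
  by rewrite le_min /peak_pos /= !ler_pdivlMr //; apply/andP; split; nra.
have Sm : S ((2 - eps) / 4).
  have s4 : 2 + eps + (2 - eps) = 4 by ring.
  exists (2 + eps, 2 - eps); rewrite /= /layer_set /peak_pos /peak /= ?s4.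
    split => /=; rewrite ?s4; [lra|lra| | |].
    - by rewrite ler_norml; lra.
    - by rewrite ler_norml; lra.
    - rewrite ler_pdivrMr //; nra.
  by apply/min_idPl; lra.
have -> : inf S = (2 - eps) / 4.
  apply/eqP; rewrite eq_le; apply/andP; split.
    by apply: ge_inf => //; exists ((2 - eps) / 4).
  by apply: lb_le_inf => //; exists ((2 - eps) / 4).
by field.
Qed.
Definition slope_bound eps : R := 2 + eps.

Definition radius eps (i : nat) : R := delta_layer eps * slope_bound eps ^- i.

End Layers.

Section Random.
Context {R : realType} {d d' : measure_display}.
Context {Omega : measurableType d} {T : measurableType d'}.
Variable P : probability Omega R.

Definition mutually_independent (X : nat -> {RV P >-> T}) : Prop :=
  forall (J : seq nat) (B : nat -> set T),
    uniq J -> (forall i, measurable (B i)) ->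
    P (\bigcap_(i in [set` J]) (X i @^-1` B i)) =
    (\prod_(i <- J) P (X i @^-1` B i))%E.

Definition iid_with_law (X : nat -> {RV P >-> T}) (mu : probability T R) : Prop :=
  (forall i B, measurable B -> distribution P (X i) B = mu B) /\
  mutually_independent X.

End Random.

Section RandomNetwork.
Context {R : realType} {d : measure_display} {Omega : measurableType d}.
Variable P : probability Omega R.
Variable X : nat -> {RV P >-> (R * R)%type}.

Definition pieces (n : nat) (w : Omega) : R :=
  (num_pieces (network (fun i => X i w) n))%:R.

Definition favorable_prob (eps : R) (m : nat) : R :=
  fine (P [set w | eta (X 0%N w) <= radius eps m]).

End RandomNetwork.

(* Main.v *)
(* If an image interval ]l, h[ of F_k contains the peak of the next favorable
   tent, it is folded into two intervals: ]a l, h'[, where l <= r_(i+1)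
   implies a l <= r_i, and ]b (1 - h), h'[, whose lower end is at most b r_m
   <= r_(m-1). Lower ends below r_0 = delta stay left of the peak, so the
   intervals reproduce at least as fast as the matrix A_m prescribes. All of
   them contain 1/2, and F_n is nowhere locally constant, so N_n is at least
   #F_n^-1(1/2), which is at least a column sum of A_m^n, when the first n
   layers are favorable. An eigenvector for the eigenvalue z bounds |z|^n by
   the largest column sum, whence N_n >= rho_m^n on an event of probability
   p_m^n and the constant c_m = 1. *)
Require Import Defs.
From HB Require Import structures.
From mathcomp Require Import all_boot all_order all_algebra.
From mathcomp Require Import complex.
From mathcomp Require Import all_classical all_reals all_analysis.
From mathcomp Require Import measurable_realfun.
From mathcomp Require Import zify ring lra.

Set Implicit Arguments.
Unset Strict Implicit.
Unset Printing Implicit Defensive.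

Import Order.TTheory GRing.Theory Num.Theory.
Import numFieldNormedType.Exports.
(* Later imports shadow [eta] and [radius]. *)
Import Defs.

Local Open Scope classical_set_scope.
Local Open Scope ring_scope.

(* The sum of column [j], counted from 0, of the [n]-th power of A_m. *)
Fixpoint lap_count (m n j : nat) : nat :=
  if n is n'.+1 then
    if (j < m)%N then (lap_count m n' 0 + lap_count m n' j.+1)%N else 0
  else (j < m)%N.

Lemma lap_count_le (m n j : nat) : (lap_count m n j.+1 <= lap_count m n j)%N.
Proof.
elim: n j => [|n IH] j /=; case: ltnP => // jm; rewrite (ltnW jm) //.
by rewrite leq_add2l IH.
Qed.

Lemma lap_count_le0 (m n j : nat) : (lap_count m n j <= lap_count m n 0)%N.
Proof. by elim: j => // j; apply: leq_trans; exact: lap_count_le. Qed.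

Lemma lap_count_out (m n j : nat) : (m <= j)%N -> lap_count m n j = 0%N.
Proof. by case: n => [|n] /=; case: ltnP. Qed.

(** * The spectral radius of A_m and the column sums of its powers *)

Section SpectralRadius.
Variable R : realType.
Local Notation normc := (@ComplexField.Normc.normc R).

Lemma normc_ge0 (z : R[i]) : 0 <= normc z.
Proof. by case: z => a b; rewrite sqrtr_ge0. Qed.

(** [eigenvalue] refers to row vectors, which is why column sums appear. Column j of A_m has its
    ones in row 0 and, if that row exists, in row j + 1. *)
Lemma step_mx_eigenvectorE (m : nat) (v : 'rV[R[i]]_m.+1) (z : R[i]) :
  v *m map_mx (real_complex R) (step_mx R m.+1) = z *: v ->
  forall j : 'I_m.+1, z * v 0 j =
    v 0 0 + (if (j.+1 < m.+1)%N then v 0 (inord j.+1) else 0).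
Proof.
move=> vA j; have := congr1 (fun u : 'rV_m.+1 => u 0 j) vA.
rewrite !mxE => <-; rewrite (bigD1 ord0) //= !mxE /= mulr1; congr (_ + _).
case: ltnP => jm.
  rewrite (bigD1 (inord j.+1)) /=; last by rewrite -val_eqE /= inordK.
  rewrite !mxE inordK // eqxx orbT mulr1 big1 ?addr0 // => i /andP[i0 ij].
  rewrite !mxE; move: i0 ij; rewrite -!val_eqE /= inordK // => /negPf -> /negPf ->.
  by rewrite mulr0.
rewrite big1 // => i i0; rewrite !mxE; move: i0; rewrite -val_eqE /= => /negPf ->.
by case: eqP => [ij|_]; rewrite ?mulr0 //; have := ltn_ord i; lia.
Qed.

(** The eigenvector equation and the triangle inequality reproduce the recursion of [lap_count]; [M]
    pays for the entries left at n = 0. *)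
Lemma eigenvector_growth (m : nat) (v : 'rV[R[i]]_m.+1) (z : R[i]) (M : R) :
  v *m map_mx (real_complex R) (step_mx R m.+1) = z *: v ->
  (forall j, normc (v 0 j) <= M) ->
  forall n (j : 'I_m.+1),
    normc z ^+ n * normc (v 0 j) <= M * (lap_count m.+1 n j)%:R.
Proof.
move=> vA vM; elim=> [|n IH] j; first by rewrite expr0 mul1r /= ltn_ord mulr1.
rewrite exprSr -mulrA -ComplexField.Normc.normcM (step_mx_eigenvectorE vA).
apply: (@le_trans _ _ (normc z ^+ n * (normc (v 0 0) +
   normc (if (j.+1 < m.+1)%N then v 0 (inord j.+1) else 0)))).
  by rewrite ler_wpM2l ?exprn_ge0 ?normc_ge0 //; exact: le_normcD.
rewrite /= ltn_ord natrD !mulrDr lerD //.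
case: ifPn => jm; first by have := IH (inord j.+1); rewrite inordK.
rewrite ComplexField.Normc.normc0 mulr0 mulr_ge0 ?ler0n //.
exact: le_trans (normc_ge0 _) (vM 0).
Qed.

Lemma eigenvalue_step_mx_le (m n : nat) (z : R[i]) :
  eigenvalue (map_mx (real_complex R) (step_mx R m.+1)) z ->
  normc z ^+ n <= (lap_count m.+1 n 0)%:R.
Proof.
case/eigenvalueP => v vA v0.
(* With an entry of largest modulus as [M], that positive modulus cancels from both sides of the
   growth bound. *)
have [j jmax] : exists j, forall i, normc (v 0 i) <= normc (v 0 j).
  have [j _ jm] := @Order.TotalTheory.arg_maxP _ R 'I_m.+1 ord0 xpredT
    (fun i => normc (v 0 i)) isT.
  by exists j => i; exact: jm.
have vj0 : 0 < normc (v 0 j).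
  rewrite lt_neqAle normc_ge0 andbT eq_sym; apply: contra v0 => /eqP vj0.
  apply/eqP/rowP => i; rewrite mxE; apply: ComplexField.Normc.eq0_normc.
  by apply/eqP; rewrite eq_le normc_ge0 andbT -vj0.
have := eigenvector_growth vA jmax n j; rewrite mulrC ler_pM2l // => le1.
by apply: (le_trans le1); rewrite ler_nat lap_count_le0.
Qed.

Lemma rho_ge0 (m : nat) : 0 <= rho R m.+1.
Proof.
rewrite /rho /spectral_radius; set S := [set _ | _ in _].
(* [sup set0] is 0 by default, so the empty set of eigenvalues is harmless. *)
have [->|/set0P[x Sx]] := eqVneq S set0; first by rewrite sup0.
apply: (@le_trans _ _ x); first by case: Sx => z _ <-; exact: normc_ge0.
apply: ub_le_sup => //; exists (lap_count m.+1 1 0)%:R => _ [z zA <-].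
by have := eigenvalue_step_mx_le 1 zA; rewrite expr1.
Qed.

Lemma rho_exprn_le (m n : nat) : (rho R m.+1) ^+ n <= (lap_count m.+1 n 0)%:R.
Proof.
case: n => [|n]; first by rewrite expr0.
set B : R := (lap_count _ _ _)%:R.
have B0 : 0 <= B by rewrite ler0n.
(* As [rho] is a supremum, it is compared with the n-th root of the column sum, which bounds every
   eigenvalue. *)
have rootB : (B `^ (n.+1%:R^-1)) ^+ n.+1 = B.
  by rewrite -powR_mulrn ?powR_ge0 // -powRrM mulVf ?powRr1 // pnatr_eq0.
rewrite -rootB; apply: lerXn2r; rewrite ?nnegrE ?rho_ge0 ?powR_ge0 //.
rewrite /rho /spectral_radius; set S := [set _ | _ in _].
have [->|/set0P S0] := eqVneq S set0; first by rewrite sup0 powR_ge0.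
apply: ge_sup => // _ [z zA <-].
rewrite -(@ler_pXn2r _ n.+1) ?nnegrE ?normc_ge0 ?powR_ge0 // rootB.
exact: eigenvalue_step_mx_le.
Qed.

End SpectralRadius.

(** * Networks are piecewise affine, so a least partition exists *)

Section PiecewiseAffine.
Variable R : realType.
Implicit Types (f g h : R -> R) (u v w x y z : R).

(** A tree of intervals rather than an indexed subdivision: refining one piece is then a [Glue],
    with no reindexing. *)
Inductive piecewise_affine f : R -> R -> Prop :=
| OnePiece u v : u < v -> affine_on `[u, v] f -> piecewise_affine f u v
| Glue u w v : piecewise_affine f u w -> piecewise_affine f w v ->
    piecewise_affine f u v.

Lemma affine_on_comp g (p q : R) (D : set R) f :
  (forall y, g y = p * y + q) -> affine_on D f -> affine_on D (g \o f).
Proof.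
move=> gE [p' [q' fE]]; exists (p * p'), (p * q' + q) => x Dx /=.
by rewrite gE fE //; ring.
Qed.

Definition ordered_on u v g h :=
  (forall x, u <= x <= v -> g x <= h x) \/ (forall x, u <= x <= v -> h x <= g x).

Lemma affine_crossing u v g h : u < v ->
  affine_on `[u, v] g -> affine_on `[u, v] h ->
  ordered_on u v g h \/
  exists w, [/\ u < w < v, ordered_on u w g h & ordered_on w v g h].
Proof.
move=> uv [p [q gE]] [p' [q' hE]].
have [pp|pp] := eqVneq p p'.
  left; have [qq|qq] := leP q q'; [left|right] => x xuv;
  by rewrite gE ?hE /= ?in_itv //= pp lerD2l // ltW.
(* The zero of [h - g], the only place where its sign can change. *)
set w := (q' - q) / (p - p').
have pp0 : p - p' != 0 by rewrite subr_eq0.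
have diffE x : u <= x <= v -> h x - g x = (p - p') * (w - x).
  by move=> xuv; rewrite gE ?hE /= ?in_itv //= /w; field.
have below a b : u <= a -> b <= v -> b <= w -> ordered_on a b g h.
  move=> ua bv bw; have [p0|p0] := leP 0 (p - p'); [left|right] => x xab;
    have /diffE : u <= x <= v by lra.
    by move=> E; rewrite -subr_ge0 E mulr_ge0 // subr_ge0; lra.
  by move=> E; rewrite -subr_le0 E nmulr_rle0 // subr_ge0; lra.
have above a b : u <= a -> b <= v -> w <= a -> ordered_on a b g h.
  move=> ua bv bw; have [p0|p0] := leP 0 (p - p'); [right|left] => x xab;
    have /diffE : u <= x <= v by lra.
    by move=> E; rewrite -subr_le0 E mulr_ge0_le0 // subr_le0; lra.
  by move=> E; rewrite -subr_ge0 E nmulr_rge0 // subr_le0; lra.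
have [uw|uw] := leP w u; first by left; apply: above.
have [vw|vw] := leP v w; first by left; apply: below.
right; exists w; split; first by rewrite uw.
- by apply: below => //; exact: ltW.
- by apply: above => //; exact: ltW.
Qed.

Lemma affine_on_sub u v u' v' f : u <= u' -> v' <= v ->
  affine_on `[u, v] f -> affine_on `[u', v'] f.
Proof.
move=> uu vv [p [q fE]]; exists p, q => x; rewrite /= in_itv /= => xuv.
by apply: fE; rewrite /= in_itv /=; lra.
Qed.

Lemma affine_on_eq (D : set R) f g : (forall x, D x -> g x = f x) ->
  affine_on D f -> affine_on D g.
Proof. by move=> fg [p [q fE]]; exists p, q => x Dx; rewrite fg ?fE. Qed.

(** Treats [min] and [max] at once: [op] picks the smaller or the larger argument, so on each side
    of the crossing it coincides with [g] or with [h]. *)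
Lemma piecewise_affine_select (op : R -> R -> R) u v g h : u < v ->
  (forall a b, a <= b -> op a b = a) \/ (forall a b, a <= b -> op a b = b) ->
  commutative op ->
  affine_on `[u, v] g -> affine_on `[u, v] h ->
  piecewise_affine (fun x => op (g x) (h x)) u v.
Proof.
move=> uv opE opC ag ah.
have ordered a b : a < b -> affine_on `[a, b] g -> affine_on `[a, b] h ->
    ordered_on a b g h -> piecewise_affine (fun x => op (g x) (h x)) a b.
  move=> ab ga ha gh; apply: OnePiece => //.
  by case: gh opE => gh [] opE;
    [apply: affine_on_eq ga|apply: affine_on_eq ha
    |apply: affine_on_eq ha|apply: affine_on_eq ga] => x;
    rewrite /= in_itv /= => /gh/opE //; rewrite opC.
have [|[w [/andP[uw wv] guw gwv]]] := affine_crossing uv ag ah.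
  exact: ordered.
by apply: (@Glue _ _ w); apply: ordered => //;
  by [apply: affine_on_sub ag; lra|apply: affine_on_sub ah; lra].
Qed.

Lemma piecewise_affine_tent (w : R * R) f u v :
  piecewise_affine f u v -> piecewise_affine (tent w \o f) u v.
Proof.
elim=> {u v} [u v uv af|u x v _ IHl _ IHr]; last exact: (Glue IHl IHr).
have : piecewise_affine
    (fun x => Num.min (w.1 * f x) (w.2 * (1 - f x))) u v.
  apply: (@piecewise_affine_select Num.min _ _
    ((fun y => w.1 * y) \o f) ((fun y => w.2 * (1 - y)) \o f)) => //.
  - by left => a b ab; apply/min_idPl.
  - exact: minC.
  - by apply: (@affine_on_comp _ w.1 0) => // y; ring.
  - by apply: (@affine_on_comp _ (- w.2) w.2) => // y; ring.
(* The pieces of the minimum are cut once more by the maximum with 0. *)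
elim=> {u v uv af} [u v uv af|u x v _ IHl _ IHr]; last exact: (Glue IHl IHr).
apply: (@piecewise_affine_select Num.max _ _ (fun=> 0)) => //.
- by right => a b ab; apply/max_idPr.
- exact: maxC.
- by exists 0, 0 => x _; rewrite mul0r addr0.
Qed.

Lemma piecewise_affine_network (om : nat -> R * R) n :
  piecewise_affine (network om n) 0 1.
Proof.
elim: n => [|n IH]; last exact: piecewise_affine_tent.
by apply: OnePiece => //; exists 1, 0 => x _; rewrite mul1r addr0.
Qed.

Lemma piecewise_affine_subdivision f u v : piecewise_affine f u v ->
  exists k (t : nat -> R), [/\ t 0%N = u, t k = v,
    forall i, (i < k)%N -> t i < t i.+1 &
    forall i, (i < k)%N -> affine_on `[t i, t i.+1] f].
Proof.
elim=> {u v} [u v uv af|u w v _ [k [t [t0 tk tS tA]]] _ [l [s [s0 sl sS sA]]]].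
  by exists 1%N, (fun i => if i is 0 then u else v); split => // -[].
pose r i := if (i <= k)%N then t i else s (i - k)%N.
(* At the joint i = k both branches give [w], so the second formula already holds there. *)
have rE i : (k <= i)%N -> r i = s (i - k)%N.
  rewrite /r; case: ltngtP => // <- _.
  by rewrite subnn s0 tk.
exists (k + l)%N, r; split.
- by rewrite /r.
- by rewrite rE ?leq_addr // addKn.
- move=> i ikl; have [ik|ki] := ltnP i k; first by rewrite /r ik (ltnW ik) tS.
  by rewrite !rE ?(leqW ki) // subSn //; apply: sS; lia.
- move=> i ikl; have [ik|ki] := ltnP i k; first by
    rewrite /r ik (ltnW ik); exact: tA.
  by rewrite !rE ?(leqW ki) // subSn //; apply: sA; lia.
Qed.

Lemma network_partition (om : nat -> R * R) n :
  exists k, affine_partition (network om n) k.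
Proof. exact: piecewise_affine_subdivision (piecewise_affine_network om n). Qed.

(** A least size exists by well-ordering, so [xget] does not fall back on its default. *)
Lemma num_piecesP f : (exists k, affine_partition f k) ->
  affine_partition f (num_pieces f) /\
  forall l, affine_partition f l -> (num_pieces f <= l)%N.
Proof.
move=> [k0 fk0]; apply: (@xgetPex _ 0%N
  [set k | affine_partition f k /\
           forall l, affine_partition f l -> (k <= l)%N]).
have exk : exists k, `[< affine_partition f k >] by exists k0; apply/asboolP.
case: (ex_minnP exk) => k /asboolP fk kmin; exists k; split=> // l fl.
by apply: kmin; apply/asboolP.
Qed.

End PiecewiseAffine.

(** * Bounding the number of pieces by fibers and by non-collinear triples *)

Section CountingPieces.
Variable R : realType.
Implicit Types (f : R -> R) (t : nat -> R) (lo u v x y z : R).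

Lemma subdivision_lt t k : (forall i, (i < k)%N -> t i < t i.+1) ->
  forall i j, (i < j)%N -> (j <= k)%N -> t i < t j.
Proof.
move=> tS i; elim=> // j IH; rewrite ltnS leq_eqVlt => /predU1P[->|ij] jk.
  exact: tS.
exact: lt_trans (IH ij (ltnW jk)) (tS _ jk).
Qed.

Lemma subdivision_le t k : (forall i, (i < k)%N -> t i < t i.+1) ->
  forall i j, (i <= j)%N -> (j <= k)%N -> t i <= t j.
Proof.
move=> tS i j; rewrite leq_eqVlt => /predU1P[-> //|ij] jk.
by apply: ltW; exact: (subdivision_lt tS).
Qed.

Lemma subdivision_locate t k x : t 0%N <= x -> x < t k ->
  exists j, [/\ (j < k)%N, t j <= x & x < t j.+1].
Proof.
move=> t0x xtk; have exj : exists j, x < t j by exists k.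
case: (ex_minnP exj) => -[|j] xtj jmin; first by rewrite ltNge t0x in xtj.
exists j; split=> //; first exact: jmin.
by rewrite leNgt; apply/negP => /jmin; rewrite ltnn.
Qed.

(** An affine piece taking the value [y] twice is constant, which is excluded; so each half-open
    piece contains at most one point of [s]. *)
Lemma affine_partition_fiber f k y (s : seq R) : affine_partition f k ->
  (forall u v, 0 <= u -> u < v -> v <= 1 -> exists2 x, u <= x <= v & f x != y) ->
  uniq s -> (forall x, x \in s -> 0 <= x < 1 /\ f x = y) -> (size s <= k)%N.
Proof.
move=> [t [t0 tk tS tA]] fN us sP.
have locate x : x \in s -> exists j, [/\ (j < k)%N, t j <= x & x < t j.+1].
  by move=> /sP[/andP[x0 x1] _]; apply: subdivision_locate; rewrite ?t0 ?tk.
have /boolp.choice[i iP] : forall x, exists j,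
    x \in s -> [/\ (j < k)%N, t j <= x & x < t j.+1].
  move=> x; have [/locate[j jP]|xs] := boolP (x \in s); first by exists j.
  by exists 0%N.
have inj : {in s &, injective i}.
  move=> x z xs zs ixz; have [ik ti1 ti2] := iP _ xs.
  have [_] := iP _ zs; rewrite -ixz => tz1 tz2.
  have [p [q fE]] := tA _ ik; apply/eqP/negPn/negP => xz.
  have mem a : t (i x) <= a <= t (i x).+1 -> f a = p * a + q.
    by move=> ha; apply: fE; rewrite /= in_itv.
  have p0 : p = 0.
    have : f x = f z by rewrite (sP _ xs).2 (sP _ zs).2.
    rewrite !mem; [|lra..]; move=> /addIr/eqP; rewrite -subr_eq0 -mulrBr mulf_eq0.
    by rewrite subr_eq0 (negPf xz) orbF => /eqP.
  have [||a ha] := fN (t (i x)) (t (i x).+1) _ (tS _ ik).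
  - by rewrite -t0; apply: (subdivision_le tS) => //; exact: ltnW.
  - by rewrite -tk; apply: (subdivision_le tS).
  by rewrite mem // -(sP _ xs).2 mem ?p0 ?mul0r ?eqxx //; lra.
rewrite -(size_map i) -(size_iota 0 k); apply: uniq_leq_size.
  by rewrite map_inj_in_uniq.
by move=> _ /mapP[x xs ->]; rewrite mem_iota /=; case: (iP _ xs).
Qed.

(** For x < y < z, the two chords of the graph have different slopes; cross-multiplied to avoid
    division. *)
Definition bent f x y z := (f y - f x) * (z - y) != (f z - f y) * (y - x).

(* Rational triples make the number of pieces a countable supremum, which is how
   its measurability is obtained. *)
Fixpoint bent_chain f lo (s : seq (rat * rat * rat)) : bool :=
  if s is (x, y, z) :: s' then
    [&& lo <= ratr x, ratr x < ratr y :> R, ratr y < ratr z :> R,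
        ratr z <= 1 :> R, bent f (ratr x) (ratr y) (ratr z) &
        bent_chain f (ratr z) s']
  else true.

Lemma bent_chain_le f lo lo' s : lo <= lo' ->
  bent_chain f lo' s -> bent_chain f lo s.
Proof.
by case: s => //= -[[x y] z] s le /and3P[h1 -> ->]; rewrite (le_trans le h1).
Qed.

(** A bent triple does not fit in one piece, so the piece containing [x] ends before [z]. Since z <=
    1, that end is an inner breakpoint. *)
Lemma bent_breakpoint f k t x y z :
  [/\ t 0%N = 0, t k = 1, forall i, (i < k)%N -> t i < t i.+1 &
      forall i, (i < k)%N -> affine_on `[t i, t i.+1] f] ->
  0 <= x -> x < y -> y < z -> z <= 1 -> bent f x y z ->
  exists j, [/\ (j < k)%N, x < t j & t j < z].
Proof.
move=> [t0 tk tS tA] x0 xy yz z1 fxyz.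
have [||j [jk tj1 tj2]] := @subdivision_locate t k x; rewrite ?t0 ?tk //.
  by lra.
have tjz : t j.+1 < z.
  rewrite ltNge; apply/negP => zt; have [p [q fE]] := tA _ jk.
  move: fxyz; rewrite /bent !fE /= ?in_itv /=; [|lra..].
  by move/eqP; apply; ring.
exists j.+1; split=> //; rewrite ltn_neqAle jk andbT.
by apply/eqP => jE; move: tjz; rewrite jE tk; lra.
Qed.

(** Each triple of the chain uses up a new inner breakpoint, since it starts no earlier than the
    previous one ends; [t j] is one already passed. *)
Lemma bent_chain_size f k t j lo s :
  [/\ t 0%N = 0, t k = 1, forall i, (i < k)%N -> t i < t i.+1 &
      forall i, (i < k)%N -> affine_on `[t i, t i.+1] f] ->
  0 <= lo -> t j <= lo -> (j < k)%N -> bent_chain f lo s -> (j + size s < k)%N.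
Proof.
move=> ft; elim: s j lo => [|[[x y] z] s IH] j lo lo0 tj jk /=.
  by rewrite addn0.
move=> /and5P[lox xy yz z1 /andP[fxyz ch]].
have [i [ik xi iz]] := bent_breakpoint ft (le_trans lo0 lox) xy yz z1 fxyz.
have ji : (j < i)%N.
  case: ltnP => // ij; case: ft => _ _ tS _.
  by have := subdivision_le tS ij (ltnW jk); lra.
have : (i + size s < k)%N by apply: (IH i (ratr z)) => //; lra.
lia.
Qed.

(** If such a triple were collinear, the affine formulas on both sides of [t i.+1] would agree, and
    dropping this breakpoint would give a smaller partition. *)
Lemma minimal_partition_bent f k t :
  [/\ t 0%N = 0, t k = 1, forall i, (i < k)%N -> t i < t i.+1 &
      forall i, (i < k)%N -> affine_on `[t i, t i.+1] f] ->
  (forall l, affine_partition f l -> (k <= l)%N) ->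
  forall i, (i.+1 < k)%N -> forall x y z,
    t i <= x -> x < t i.+1 -> t i.+1 < y -> y < z -> z <= t i.+2 ->
    bent f x y z.
Proof.
move=> [t0 tk tS tA] kmin i ik x y z tx xt ty yz zt; apply/negP => /eqP.
have [p [q fE]] := tA _ (ltnW ik); have [p' [q' fE']] := tA _ ik.
rewrite (fE x) ?(fE' y) ?(fE' z) /= ?in_itv /=; [|lra..].
have ftE : p * t i.+1 + q = p' * t i.+1 + q'.
  by rewrite -fE ?(fE' (t i.+1)) //= in_itv /= lexx ltW ?tS // ltnW.
move=> E.
(* Collinearity puts (x, f x) on the right-hand line; the left-hand line meets it at [t i.+1] too,
   so the two coincide. *)
have [yz0 xt0] : z - y != 0 /\ x - t i.+1 != 0 by split; lra.
have E1 : p' * y + q' - (p * x + q) = p' * (y - x).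
  by apply: (mulIf yz0); rewrite E; ring.
have pp : p = p'.
  apply/eqP; rewrite -subr_eq0; have /eqP : (p - p') * (x - t i.+1) = 0 by lra.
  by rewrite mulf_eq0 (negPf xt0) orbF.
have qq : q = q' by move: ftE; rewrite pp => /addrI.
suff /kmin : affine_partition f k.-1 by lia.
(* The subdivision with index i + 1 left out. *)
exists (fun j => if (j <= i)%N then t j else t j.+1); split => [//||j jk|j jk].
- by case: ifP => h; [lia|rewrite prednK //; lia].
- case: (ltngtP j i) => [ji|ij|->].
  + by apply: tS; lia.
  + by apply: tS; lia.
  + by apply: lt_trans (tS i _) (tS i.+1 _); lia.
case: (ltngtP j i) => [ji|ij|->].
- by apply: tA; lia.
- by apply: tA; lia.
exists p, q => a; rewrite /= in_itv /= => ha.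
have [at1|ta] := leP a (t i.+1).
  by apply: fE; rewrite /= in_itv /= at1; lra.
by rewrite pp qq; apply: fE'; rewrite /= in_itv /= ltW //; lra.
Qed.

(** Each of the k - 1 inner breakpoints gets a rational triple around it, kept between the midpoints
    of the adjacent pieces so that successive triples do not overlap. *)
Lemma minimal_partition_bent_chain f k : affine_partition f k ->
  (forall l, affine_partition f l -> (k <= l)%N) ->
  exists s, size s = k.-1 /\ bent_chain f 0 s.
Proof.
move=> [t ft] kmin; have fbent := minimal_partition_bent ft kmin.
have [t0 tk tS _] := ft.
pose mid i := (t i + t i.+1) / 2.
have midP i : (i < k)%N -> t i < mid i < t i.+1.
  by move=> /tS ti; rewrite /mid; lra.
have k0 : (0 < k)%N.
  by case: k tk {ft kmin fbent tS midP} => // t01; move: t0; rewrite t01; lra.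
have : exists s, size s = k.-1 /\ bent_chain f (mid 0%N) s.
  have : (0 + k.-1).+1 = k by rewrite add0n prednK.
  elim: (k.-1) {k0} 0%N => [|d IH] i ik; first by exists [::].
  have [|s [sd ch]] := IH i.+1; first by lia.
  have /midP/andP[mi1 mi2] : (i < k)%N by lia.
  have ik' : (i.+1 < k)%N by lia.
  have /andP[mj1 mj2] := midP _ ik'.
  have [x /itvP xP] := rat_in_itvoo mi2.
  have [y /itvP yP] := rat_in_itvoo mj1.
  have ymid : ratr y < mid i.+1 by rewrite yP.
  have [z /itvP zP] := rat_in_itvoo ymid.
  have tj1 : t i.+2 <= 1 by rewrite -tk; exact: (subdivision_le tS).
  have [x1 x2] : mid i < ratr x /\ ratr x < t i.+1 by rewrite !xP.
  have [y1 y2] : t i.+1 < ratr y /\ ratr y < mid i.+1 by rewrite !yP.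
  have [z1 z2] : ratr y < ratr z :> R /\ ratr z < mid i.+1 by rewrite !zP.
  exists ((x, y, z) :: s); split; first by rewrite /= sd.
  apply/and5P; split; [lra..|]; apply/andP; split.
    by apply: (fbent i) => //; lra.
  by apply: bent_chain_le ch; lra.
move=> [s [sk ch]]; exists s; split=> //; apply: bent_chain_le ch.
by have := midP _ k0; rewrite t0; lra.
Qed.

Lemma num_pieces_gtP f k : (exists l, affine_partition f l) ->
  (k < num_pieces f)%N <-> exists s, (k <= size s)%N /\ bent_chain f 0 s.
Proof.
move=> /num_piecesP[fN Nmin]; split=> [kN|[s [ks ch]]].
  have [s [sN ch]] := minimal_partition_bent_chain fN Nmin.
  by exists s; split=> //; lia.
case: fN => t ft; apply: (leq_ltn_trans ks).
apply: (bent_chain_size (j := 0%N) ft _ _ _ ch) => //; first by case: ft => ->.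
case: ft => t0; case: (num_pieces f) => // t1; move: t0; rewrite t1; lra.
Qed.

End CountingPieces.

(** * Preimages of 1/2 under favorable layers *)

Section FavorableLayers.
Variable R : realType.
Implicit Types (eps x y : R) (w : R * R) (om : nat -> R * R).

(** [network] peels off the last layer, whereas preimages are built by induction from the first. *)
Lemma network_first om n x :
  network om n.+1 x = network (fun i => om i.+1) n (tent (om 0%N) x).
Proof. by elim: n x => //= n IH x; rewrite -IH. Qed.

Lemma tent_unit w x : 0 < w.1 -> 0 < w.2 -> 0 <= x <= 1 ->
  tent w x = Num.min (w.1 * x) (w.2 * (1 - x)).
Proof.
move=> a0 b0 x01; apply/max_idPr.
by rewrite le_min; apply/andP; split; nra.
Qed.

Lemma tent_le_peak w x : 0 < w.1 -> 0 < w.2 -> 0 <= x <= 1 ->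
  0 <= tent w x <= peak w.
Proof.
move=> a0 b0 x01; rewrite /tent le_max lexx /= ge_max; apply/andP; split.
  by rewrite /peak divr_ge0 ?mulr_ge0 ?addr_ge0 ?ltW.
rewrite /peak ler_pdivlMr ?addr_gt0 //.
set M := Num.min _ _.
have M1 : M <= w.1 * x by rewrite ge_min lexx.
have M2 : M <= w.2 * (1 - x) by rewrite ge_min lexx orbT.
(* Add b M <= a b x and a M <= a b (1 - x). *)
nra.
Qed.

(** The first tent gives each value z at most the preimages z / a and 1 - z / b, and peaks at most 1
    keep the argument of the remaining network in the unit interval. *)
Lemma network_fiber_finite om n y :
  (forall i, (i < n)%N -> [/\ 0 < (om i).1, 0 < (om i).2 & peak (om i) <= 1]) ->
  exists s : seq R, forall x, 0 <= x <= 1 -> network om n x = y -> x \in s.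
Proof.
elim: n om => [|n IH] om omP.
  by exists [:: y] => x _ /= ->; rewrite mem_head.
have [s sP] := IH (fun i => om i.+1) (fun i => omP i.+1).
have [//|a0 b0 h1] := omP 0%N.
exists ([seq z / (om 0%N).1 | z <- s] ++ [seq 1 - z / (om 0%N).2 | z <- s]).
move=> x x01; rewrite network_first => /sP.
have /andP[t0 th] := tent_le_peak a0 b0 x01.
rewrite t0 (le_trans th h1) => /(_ isT) zs.
rewrite mem_cat; apply/orP; move: zs; rewrite tent_unit // minElt.
by case: ifP => _ zs; [left|right]; apply/mapP;
  [exists ((om 0%N).1 * x)|exists ((om 0%N).2 * (1 - x))] => //; field;
  rewrite gt_eqF.
Qed.

Lemma not_constant_on_interval (f : R -> R) y (s : seq R) :
  (forall x, 0 <= x <= 1 -> f x = y -> x \in s) ->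
  forall u v, 0 <= u -> u < v -> v <= 1 -> exists2 x, u <= x <= v & f x != y.
Proof.
move=> sP u v u0 uv v1; apply/not_exists2P => fy.
(* Distinct equally spaced points of [u, v], one more than [s] can contain. *)
pose g (i : nat) := u + (v - u) * (i%:R / (size s).+1%:R).
have gi : injective g.
  move=> i j /addrI/mulfI; rewrite subr_eq0 gt_eqF // => /(_ isT).
  by move/divIf => /(_ _)/eqP; rewrite pnatr_eq0 eqr_nat => /(_ isT)/eqP.
have : (size (map g (iota 0 (size s).+1)) <= size s)%N.
  apply: uniq_leq_size; first by rewrite map_inj_uniq ?iota_uniq.
  move=> _ /mapP[i iI ->]; have il : (i <= size s)%N by rewrite mem_iota in iI.
  have gu : u <= g i <= v.
    have r0 : 0 <= (i%:R / (size s).+1%:R : R) by rewrite divr_ge0 ?ler0n.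
    have r1 : (i%:R / (size s).+1%:R : R) <= 1.
      by rewrite ler_pdivrMr ?ltr0n // mul1r ler_nat leqW.
    rewrite /g; move: (_ / _) r0 r1 => r r0 r1.
    by apply/andP; split; nra.
  apply: sP; first by lra.
  by have [|] := fy (g i) => // /negP; rewrite negbK => /eqP.
by rewrite size_map size_iota ltnn.
Qed.

(** Membership in [layer_set eps] is included because the law guarantees it only almost surely. *)
Definition favorable eps m : set (R * R) :=
  [set w | layer_set eps w /\ eta w <= radius eps m].

(** The peak position is extremal when one slope is 2 - eps and the other 2 + eps, whence the margin
    [2 * delta_layer eps]. *)
Lemma favorable_bounds eps m w : 0 < eps -> eps < 1 -> favorable eps m w ->
  [/\ 0 < w.1 <= slope_bound eps, 0 < w.2 <= slope_bound eps,
      peak w <= 1, 1 - radius eps m <= peak w &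
      2 * delta_layer eps <= peak_pos w <= 1 - 2 * delta_layer eps].
Proof.
move=> e0 e1 [[a0 b0]]; rewrite !ler_norml => a2 b2 h1.
rewrite /eta /slope_bound => hr; split; rewrite ?a0 ?b0 /=; [lra..|].
have ab0 : 0 < w.1 + w.2 by rewrite addr_gt0.
rewrite delta_layerE // /peak_pos ler_pdivlMr // ler_pdivrMr //.
by apply/andP; split; nra.
Qed.

Lemma radius_ge0 eps i : 0 < eps -> eps < 1 -> 0 < radius eps i.
Proof.
move=> e0 e1; rewrite /radius delta_layerE // divr_gt0 //; first by lra.
by rewrite exprn_gt0 // /slope_bound; lra.
Qed.

Lemma radiusS eps i : 0 < eps -> slope_bound eps * radius eps i.+1 = radius eps i.
Proof.
move=> e0; rewrite /radius exprS; field.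
by rewrite expf_neq0 // /slope_bound; lra.
Qed.

Lemma radius_le eps i : 0 < eps -> eps < 1 -> radius eps i <= delta_layer eps.
Proof.
move=> e0 e1; elim: i => [|i IH]; first by rewrite /radius expr0 invr1 mulr1.
apply: le_trans IH; rewrite -(radiusS i e0) /slope_bound.
by have := radius_ge0 i.+1 e0 e1; nra.
Qed.

(* Type [j] (from 0) stands for [l <= radius eps (m - j)]; a favorable tent turns
   type [j] into types [0] and [j.+1]. *)
Lemma level_preimages eps m (n : nat) : 0 < eps -> eps < 1 ->
  forall om j l h, (forall i, (i < n)%N -> favorable eps m.+1 (om i)) ->
  0 <= l -> l <= radius eps (m - j) -> 1 - radius eps m.+1 <= h -> h <= 1 ->
  exists s : seq R, [/\ size s = lap_count m.+1 n j, uniq s &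
    forall x, x \in s -> l < x < h /\ network om n x = 1 / 2].
Proof.
move=> e0 e1; have rd i := radius_le i e0 e1; have dE := delta_layerE e0 e1.
elim: n => [|n IH] om j l h omP l0 lr rh h1 /=.
  case: ltnP => _; last by exists [::].
  (* [delta_layer eps] is below 1/4, so l < 1/2 < h. *)
  exists [:: 1 / 2]; split=> // x; rewrite inE => /eqP ->; split=> //.
  by have := rd (m - j)%N; have := rd m.+1; lra.
case: ltnP => jm; last by exists [::].
have [//|/andP[a0 aK] /andP[b0 bK] p1 pr /andP[c0 c1]] :=
  favorable_bounds e0 e1 (omP 0%N _).
set w := om 0%N in a0 aK b0 bK p1 pr c0 c1.
have om'P i : (i < n)%N -> favorable eps m.+1 (om i.+1) by exact: (omP i.+1).
have rm0 := radius_ge0 m.+1 e0 e1.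
(* Image of the right branch: its lower end is at most K r_(m+1) = r_m, that is, type 0. *)
have [s2 [s2s s2u s2P]] : exists s : seq R,
  [/\ size s = lap_count m.+1 n 0, uniq s & forall x, x \in s ->
     w.2 * (1 - h) < x < peak w /\ network (fun i => om i.+1) n x = 1 / 2].
  apply: IH => //; first by rewrite mulr_ge0 ?subr_ge0 // ltW.
  by rewrite subn0 -radiusS //; apply: ler_pM; [exact: ltW|lra|done|lra].
(* Image of the left branch: the lower end moves up one radius, to type j + 1. For j = m the
   required list is empty. *)
have [s1 [s1s s1u s1P]] : exists s : seq R,
  [/\ size s = lap_count m.+1 n j.+1, uniq s & forall x, x \in s ->
     w.1 * l < x < peak w /\ network (fun i => om i.+1) n x = 1 / 2].
  move: jm; rewrite ltnS leq_eqVlt => /predU1P[->|jm].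
    by exists [::]; rewrite lap_count_out.
  apply: IH => //; first by rewrite mulr_ge0 // ltW.
  rewrite -(radiusS _ e0) subnSK //.
  by apply: ler_pM; [exact: ltW|done|done|done].
have ab0 : 0 < w.1 + w.2 by rewrite addr_gt0.
have pa : peak w = w.1 * peak_pos w by rewrite /peak /peak_pos mulrA.
have pb : peak w = w.2 * (1 - peak_pos w).
  by rewrite /peak /peak_pos; field; rewrite gt_eqF.
(* The peak position is at least 2 delta away from 0 and 1, while [l] and [1 - h] are at most
   delta. *)
have lc : l < peak_pos w by have := rd (m - j)%N; lra.
have ch : peak_pos w < h by have := rd m.+1; lra.
have s1E x : x \in s1 -> l < x / w.1 < peak_pos w /\
    network om n.+1 (x / w.1) = 1 / 2.
  move=> /s1P[/andP[lx xp] fx].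
  have xB : l < x / w.1 < peak_pos w.
    by rewrite ltr_pdivlMr // ltr_pdivrMr // mulrC lx mulrC -pa.
  split=> //; rewrite network_first -fx -/w tent_unit //; last by lra.
  have xE : w.1 * (x / w.1) = x by field; rewrite gt_eqF.
  congr network; rewrite xE; apply/min_idPl.
  rewrite (le_trans (ltW xp)) // pb ler_pM2l //; lra.
have s2E x : x \in s2 -> peak_pos w < 1 - x / w.2 < h /\
    network om n.+1 (1 - x / w.2) = 1 / 2.
  move=> /s2P[/andP[lx xp] fx].
  have xB : peak_pos w < 1 - x / w.2 < h.
    have : 1 - h < x / w.2 < 1 - peak_pos w.
      by rewrite ltr_pdivlMr // ltr_pdivrMr // mulrC lx mulrC -pb.
    lra.
  split=> //; rewrite network_first -fx -/w tent_unit //; last by lra.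
  have xE : w.2 * (1 - (1 - x / w.2)) = x by field; rewrite gt_eqF.
  congr network; rewrite xE; apply/min_idPr.
  rewrite (le_trans (ltW xp)) // pa ler_pM2l //; lra.
(* Both lists are pulled back through the inverse branches; the results lie on opposite sides of the
   peak position, hence are disjoint. *)
exists ([seq 1 - x / w.2 | x <- s2] ++ [seq x / w.1 | x <- s1]); split.
- by rewrite size_cat !size_map s1s s2s.
- rewrite cat_uniq !map_inj_in_uniq ?s1u ?s2u ?andbT /=.
  + apply/hasPn => _ /mapP[x /s1E[xB _] ->]; apply/negP => /mapP[z /s2E[zB _] E].
    by move: xB zB; rewrite E; lra.
  + by move=> x z _ _; apply: mulIf; rewrite invr_eq0 gt_eqF.
  + by move=> x z _ _ /addrI/oppr_inj; apply: mulIf; rewrite invr_eq0 gt_eqF.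
move=> z; rewrite mem_cat => /orP[] /mapP[x].
  by move=> /s2E[xB fx] ->; split=> //; lra.
by move=> /s1E[xB fx] ->; split=> //; lra.
Qed.

Lemma num_pieces_ge eps m n om : 0 < eps -> eps < 1 ->
  (forall i, (i < n)%N -> favorable eps m.+1 (om i)) ->
  (lap_count m.+1 n 0 <= num_pieces (network om n))%N.
Proof.
move=> e0 e1 omP.
have [fN _] := num_piecesP (network_partition om n).
have omP' i : (i < n)%N -> [/\ 0 < (om i).1, 0 < (om i).2 & peak (om i) <= 1].
  by move=> /omP/(favorable_bounds e0 e1)[/andP[-> _] /andP[-> _] -> _ _].
have [s' s'P] := network_fiber_finite (1 / 2) omP'.
have r0 i := ltW (radius_ge0 i e0 e1).
(* The starting interval ]0, 1[ has type 0. *)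
have [||||s [<- us sP]] := @level_preimages eps m n e0 e1 om 0%N 0 1 omP => //.
  by have := r0 m.+1; lra.
apply: (affine_partition_fiber fN (not_constant_on_interval s'P) us).
by move=> x /sP[/andP[x0 x1] ->]; rewrite x1 ltW.
Qed.

Lemma num_pieces_gt0 om n : (0 < num_pieces (network om n))%N.
Proof.
have [[t [t0 t1 _ _]] _] := num_piecesP (network_partition om n).
by case: num_pieces t1 => // /eqP; rewrite t0 eq_sym oner_eq0.
Qed.

End FavorableLayers.

(** * Measurability of the number of pieces and of the layer events *)

Lemma measurable_bool d (T : measurableType d) (b : T -> bool) :
  measurable_fun setT b -> measurable [set w | b w].
Proof.
move=> mb; rewrite -[X in measurable X]setTI.
exact: (mb measurableT [set true]).
Qed.

Section Measurability.
Context {R : realType} {d : measure_display} {Omega : measurableType d}.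
Implicit Types (f : Omega -> R).

Lemma measurable_funV f : measurable_fun setT f ->
  measurable_fun setT (fun w => (f w)^-1).
Proof.
(* Real powers only invert nonnegative numbers. *)
move=> mf; rewrite (_ : (fun w => _) = f \* (fun w => (f w ^+ 2) `^ (-1))).
  apply: measurable_funM => //.
  apply: (measurableT_comp (measurable_powR _)).
  exact: measurable_funX.
apply/funext => w /=; rewrite powR_inv1 ?sqr_ge0 //.
have [->|f0] := eqVneq (f w) 0; first by rewrite invr0 mul0r.
by field.
Qed.

Lemma measurable_tent (X : Omega -> R * R) f :
  measurable_fun setT X -> measurable_fun setT f ->
  measurable_fun setT (fun w => tent (X w) (f w)).
Proof.
move=> /measurable_fun_pairP[mX1 mX2] mf; apply: measurable_maxr => //.
apply: measurable_minr; apply: measurable_funM => //.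
exact: measurable_funB.
Qed.

Lemma measurable_network (X : nat -> Omega -> R * R) n x :
  (forall i, measurable_fun setT (X i)) ->
  measurable_fun setT (fun w => network (fun i => X i w) n x).
Proof.
by move=> mX; elim: n => [|n IH] //=; exact: measurable_tent.
Qed.

Lemma measurable_bent_chain (F : Omega -> R -> R) lo s :
  (forall x, measurable_fun setT (F^~ x)) ->
  measurable [set w | bent_chain (F w) lo s].
Proof.
move=> mF; elim: s lo => [|[[x y] z] s IH] lo /=; first by rewrite set_true.
rewrite (_ : [set w | _] =
  [set w | [&& lo <= ratr x, ratr x < ratr y :> R, ratr y < ratr z :> R &
               ratr z <= 1 :> R]] `&`
  ([set w | bent (F w) (ratr x) (ratr y) (ratr z)] `&`
   [set w | bent_chain (F w) (ratr z) s])); last first.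
  apply/seteqP; split=> w /=.
    by move=> /and5P[-> -> -> ->] /andP[-> ->].
  by move=> [/and4P[-> -> -> ->] [-> ->]].
(* The order conditions do not involve the sample point: this set is empty or everything. *)
apply: measurableI; first by case: and4P => _; rewrite ?set_true ?set_false.
apply: measurableI; last exact: IH.
have mE : measurable_fun setT (fun w =>
    (F w (ratr y) - F w (ratr x)) * (ratr z - ratr y) ==
    (F w (ratr z) - F w (ratr y)) * (ratr y - ratr x)).
  apply: measurable_fun_eqr; apply: measurable_funM => //;
  exact: measurable_funB.
rewrite (_ : [set w | _] = ~` [set w |
    (F w (ratr y) - F w (ratr x)) * (ratr z - ratr y) ==
    (F w (ratr z) - F w (ratr y)) * (ratr y - ratr x)]).
  exact/measurableC/measurable_bool.
by apply/seteqP; split=> w /= /negP.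
Qed.

(** By [num_pieces_gtP] the event is a union over the countably many rational chains. *)
Lemma measurable_pieces_gt (X : nat -> Omega -> R * R) n k :
  (forall i, measurable_fun setT (X i)) ->
  measurable [set w | (k < num_pieces (network (fun i => X i w) n))%N].
Proof.
move=> mX; rewrite (_ : [set w | _] = \bigcup_s
   (if (k <= size s)%N then
      [set w | bent_chain (network (fun i => X i w) n) 0 s] else set0)).
  apply: countable_bigcupT_measurable => // s; case: ifP => // _.
  by apply: measurable_bent_chain => x; exact: measurable_network.
apply/seteqP; split=> w /=.
  move=> /(num_pieces_gtP _ (network_partition _ _))[s [ks ch]].
  by exists s => //; rewrite ks.
move=> [s _]; case: ifP => // ks ch.
by apply/(num_pieces_gtP _ (network_partition _ _)); exists s.
Qed.

End Measurability.

Section LayerEvents.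
Variable R : realType.

Lemma measurable_peak : measurable_fun [set: R * R] (@peak R).
Proof.
apply: measurable_funM; first exact: measurable_funM.
by apply: measurable_funV; exact: measurable_funD.
Qed.

Lemma measurable_eta_le (r : R) : measurable [set w : R * R | eta w <= r].
Proof.
apply: measurable_bool; apply: measurable_fun_ler => //.
by apply: measurable_funB => //; exact: measurable_peak.
Qed.

Lemma measurable_layer_set (eps : R) : measurable (layer_set eps).
Proof.
have mnorm (f : R * R -> R) : measurable_fun setT f ->
    measurable_fun setT (fun w => `|f w - 2|).
  move=> mf; apply: (@measurableT_comp _ _ _ _ _ _ (@Num.norm R R)) => //.
  exact: measurable_funB.
rewrite (_ : layer_set eps = [set w | 0 < w.1] `&` [set w | 0 < w.2] `&`
  [set w | `|w.1 - 2| <= eps] `&` [set w | `|w.2 - 2| <= eps] `&`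
  [set w | peak w <= 1]); last first.
  by apply/seteqP; split=> w /=; [case|case; case; case; case].
have mnorm_le (f : R * R -> R) : measurable_fun setT f ->
    measurable [set w | `|f w - 2| <= eps].
  move=> mf; apply: measurable_bool; apply: measurable_fun_ler => //.
  exact: mnorm.
do 4?[apply: measurableI].
- by apply: measurable_bool; exact: measurable_fun_ltr.
- by apply: measurable_bool; exact: measurable_fun_ltr.
- exact: mnorm_le.
- exact: mnorm_le.
by apply: measurable_bool; apply: measurable_fun_ler => //; exact: measurable_peak.
Qed.

End LayerEvents.

(** * Probability that the first n layers are favorable *)

Section FavorableEvents.
Context {R : realType} {d : measure_display} {Omega : measurableType d}.
Variables (P : probability Omega R) (X : nat -> {RV P >-> (R * R)%type}).
Variables (mu : probability (R * R)%type R) (eps : R) (m : nat).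
Hypotheses (hmu : mu (layer_set eps) = 1%E) (hX : iid_with_law X mu).

Lemma measurable_favorable : measurable (favorable eps m).
Proof. exact: measurableI (measurable_layer_set _) (measurable_eta_le _). Qed.

Lemma probability_favorable i :
  P (X i @^-1` favorable eps m) = (favorable_prob X eps m)%:E.
Proof.
have [law _] := hX.
rewrite /favorable_prob fineK ?fin_num_measure //; last first.
  exact: (measurable_funPTI (X 0%N) (measurable_eta_le _)).
have -> : P (X i @^-1` favorable eps m) = mu (favorable eps m).
  exact: (law i _ measurable_favorable).
have -> : P [set w | eta (X 0%N w) <= radius eps m] =
    mu [set w | eta w <= radius eps m].
  exact: (law 0%N _ (measurable_eta_le _)).
have mL := measurable_layer_set eps; have mE := measurable_eta_le (radius eps m).
(* Split along [layer_set eps], whose complement is null. *)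
rewrite -[in RHS](setIT [set w | _]) -(setUv (layer_set eps)) setIUr measureU //.
- rewrite [X in (_ + X)%E](_ : _ = 0%E) ?adde0; first by rewrite setIC.
  apply/eqP; rewrite eq_le measure_ge0 andbT.
  apply: (@le_trans _ _ (mu (~` layer_set eps))).
    by apply: le_measure; rewrite ?inE //; do ?exact: measurableC;
      apply: measurableI => //; exact: measurableC.
  by rewrite probability_setC // hmu subee.
- exact: measurableI.
- by apply: measurableI => //; exact: measurableC.
- by rewrite setIACA setICr setI0.
Qed.

Lemma favorable_prob_itv : 0 <= favorable_prob X eps m <= 1.
Proof.
rewrite -!lee_fin -(probability_favorable 0) measure_ge0 /=.
exact: probability_le1 (measurable_funPTI _ measurable_favorable).
Qed.

(** Indexed by a list, in the shape of [mutually_independent]. *)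
Definition all_favorable n := \bigcap_(i in [set` iota 0 n])
  (X i @^-1` favorable eps m).

Lemma all_favorableP n w : all_favorable n w ->
  forall i, (i < n)%N -> favorable eps m (X i w).
Proof. by move=> h i ltin; apply: (h i); rewrite /= mem_iota. Qed.

Lemma measurable_all_favorable n : measurable (all_favorable n).
Proof.
apply: bigcap_measurableType => i _.
exact: measurable_funPTI measurable_favorable.
Qed.

Lemma probability_all_favorable n :
  P (all_favorable n) = (favorable_prob X eps m ^+ n)%:E.
Proof.
have [_ indep] := hX.
rewrite /all_favorable (indep _ (fun=> favorable eps m) (iota_uniq 0 n)); last first.
  by move=> _; exact: measurable_favorable.
under eq_bigr do rewrite probability_favorable.
by rewrite prodEFin big_const_seq count_predT size_iota iter_mulr_1.
Qed.

End FavorableEvents.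

(** * Bounds for the random number of pieces, and the conclusion *)

Lemma measurable_pieces (R : realType) (d : measure_display)
    (Omega : measurableType d) (P : probability Omega R)
    (X : nat -> {RV P >-> (R * R)%type}) n :
  measurable_fun setT (pieces X n).
Proof.
have mgt k := measurable_pieces_gt n k (fun i => measurable_funPT (X i)).
have meq k : measurable
    [set w | num_pieces (network (fun i => X i w) n) = k].
  case: k => [|k].
    rewrite (_ : [set w | _] = set0) //; apply/seteqP; split=> // w /= N0.
    by have := num_pieces_gt0 (fun i => X i w) n; rewrite N0.
  rewrite (_ : [set w | _] =
      [set w | (k < num_pieces (network (fun i => X i w) n))%N] `\`
      [set w | (k.+1 < num_pieces (network (fun i => X i w) n))%N]).
    by apply: measurableD; exact: mgt.
  by apply/seteqP; split=> w /= => [->|[]]; [split=> //; rewrite ltnn|lia].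
(* The count takes only natural values, so a preimage is a countable union of level sets. *)
move=> _ B mB; rewrite setTI (_ : _ @^-1` _ = \bigcup_k
    (if k%:R \in B then
       [set w | num_pieces (network (fun i => X i w) n) = k] else set0)).
  by apply: bigcup_measurable => k _; case: ifP.
apply/seteqP; split=> w /=.
  by move=> Bw; exists (num_pieces (network (fun i => X i w) n)) => //; rewrite mem_set.
by move=> [k _]; case: ifP => // kB wk; rewrite /pieces wk; exact: set_mem.
Qed.

Lemma rho_le_pieces (R : realType) (d : measure_display)
    (Omega : measurableType d) (P : probability Omega R)
    (X : nat -> {RV P >-> (R * R)%type}) eps m n w : 0 < eps -> eps < 1 ->
  all_favorable X eps m.+1 n w -> rho R m.+1 ^+ n <= pieces X n w.
Proof.
move=> e0 e1 Aw; apply: le_trans (rho_exprn_le R m n) _; rewrite ler_nat.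
exact: num_pieces_ge e0 e1 (all_favorableP Aw).
Qed.

Lemma le_limn_einf (R : realType) (u : (\bar R)^nat) (l : \bar R) :
  (forall n, (l <= u n)%E) -> (l <= limn_einf u)%E.
Proof.
move=> lu; rewrite limn_einf_lim; apply: lime_ge; first exact: is_cvg_einfs.
by apply: nearW => n; apply: le_ereal_inf_tmp => _ [k _ <-].
Qed.

Theorem theorem2p5 (R : realType) (m : nat) (hm : (1 <= m)%N) :
  exists c : R, 0 < c /\
  forall (eps : R) (heps0 : 0 < eps) (heps1 : eps < 1)
    (mu : probability (R * R)%type R) (hmu : mu (layer_set eps) = 1%E)
    (d : measure_display) (Omega : measurableType d)
    (P : probability Omega R) (X : nat -> {RV P >-> (R * R)%type})
    (hX : iid_with_law X mu),
  let p := favorable_prob X eps m in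
  [/\ 0 < p -> forall delta : R, 0 < delta ->
        ((ln p)%:E <=
         limn_einf (fun n : nat =>
           (n%:R^-1)%:E *
           lne (P [set w | (n%:R^-1 * ln (pieces X n w) >=
                            ln (rho R m) - delta)%R])))%E,
      forall n : nat, (1 <= n)%N ->
        ((c * (p * rho R m) ^+ n)%:E <= 'E_P[pieces X n])%E &
      1 < p * rho R m ->
        exists C lam : R, [/\ 0 < C, 1 < lam &
          forall n : nat, (1 <= n)%N ->
            ((C * lam ^+ n)%:E <= 'E_P[pieces X n])%E]].
Proof.
case: m hm => // m _; exists 1; split=> // eps e0 e1 mu hmu d Omega P X hX p.
have /andP[p0 p1] := favorable_prob_itv m.+1 hmu hX.
have PA n := probability_all_favorable m.+1 hmu hX n.
have mA n : measurable (all_favorable X eps m.+1 n) := measurable_all_favorable _ _ _ _.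
have mN n := measurable_pieces X n.
have expect n : (((p * rho R m.+1) ^+ n)%:E <= 'E_P[pieces X n])%E.
  have r0 : (0 <= (rho R m.+1 ^+ n)%:E)%E by rewrite lee_fin exprn_ge0 ?rho_ge0.
  have m1 : measurable_fun setT (EFin \o \1_(all_favorable X eps m.+1 n) : Omega -> \bar R).
    by apply/measurable_EFinP; exact: measurable_indic.
  (* By independence, (p rho)^n is the integral of rho^n times the indicator of [all_favorable],
     which [pieces] dominates pointwise. *)
  rewrite unlock exprMn mulrC EFinM -PA -[all_favorable _ _ _ _]setIT.
  rewrite -integral_indic // -ge0_integralZl //.
  apply: ge0_le_integral => //.
  - by move=> w _; rewrite mule_ge0.
  - exact: measurable_funeM.
  - exact/measurable_EFinP.
  move=> w _; rewrite -EFinM lee_fin indicE.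
  case: (boolP (w \in _)) => [/set_mem Aw|_]; last by rewrite mulr0.
  by rewrite mulr1; exact: rho_le_pieces Aw.
split.
- move=> p_gt0 delta delta0; apply: le_limn_einf => -[|n].
    (* At n = 0 the inverse is 0 by default, and ln p <= 0. *)
    by rewrite invr0 mul0e lee_fin ln_le0.
  set B := [set w | _].
  have mB : measurable B.
    apply: measurable_bool; apply: measurable_fun_ler => //.
    by apply: measurable_funM => //; exact: (measurableT_comp (@measurable_ln R) (mN n.+1)).
  have AB : all_favorable X eps m.+1 n.+1 `<=` B.
    move=> w Aw; rewrite /B /=.
    have N1 : 1 <= pieces X n.+1 w by rewrite ler1n num_pieces_gt0.
    apply: (@le_trans _ _ (ln (rho R m.+1))); first by rewrite gerBl ltW.
    rewrite mulrC ler_pdivlMr ?ltr0n // mulrC.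
    (* If rho vanishes, [ln] has the default value 0, and N_n >= 1 suffices. *)
    have [r0|r0] := leP (rho R m.+1) 0; first by rewrite ln0 ?mul0r ?mulr0 // ln_ge0.
    rewrite mulr_natl -lnXn // ler_ln ?posrE ?exprn_gt0 //.
      exact: rho_le_pieces Aw.
    exact: lt_le_trans N1.
  have pB : ((p ^+ n.+1)%:E <= P B)%E.
    by rewrite -PA; apply: le_measure; rewrite ?inE.
  have lnp : lne (p ^+ n.+1)%:E = ((ln p) *+ n.+1)%:E.
    by rewrite lne_EFin ?exprn_gt0 // lnXn.
  (* The lower bound p^n for P(B) has normalised logarithm exactly ln p. *)
  apply: (@le_trans _ _ ((n.+1%:R^-1)%:E * lne (p ^+ n.+1)%:E)%E).
    by rewrite lnp -EFinM -[ln p *+ _]mulr_natl mulrA mulVf ?mul1r.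
  apply: lee_wpmul2l; first by rewrite lee_fin invr_ge0.
  rewrite lee_lne // in_itv /= leey andbT.
    by rewrite lee_fin exprn_ge0.
  exact: measure_ge0.
- by move=> n _; rewrite mul1r.
- by move=> pr; exists 1, (p * rho R m.+1); split=> // n _; rewrite mul1r.
Qed.
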